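(* For $n>0$ and $J\subseteq S$, there are bijections $\mathfrak{S}_n^J(231)\simeq \mathrm{NC}_n^J\simeq \mathrm{NN}_n^J$. In particular these three sets have the same cardinality.
   Context: Let $\mathfrak{S}_n$ be the symmetric group on $[n]=\{1,\dots,n\}$, $s_i=(i,i+1)$, $S=\{s_1,\dots,s_{n-1}\}$, permutations written in one-line notation $w=w_1\cdots w_n$. The inversion set is $\mathrm{inv}(w)=\{(i,j):i<j,\ w_i>w_j\}$, and $u\le_S v$ iff $\mathrm{inv}(u)\subseteq\mathrm{inv}(v)$. For $J\subseteq S$, $\mathfrak{S}_n^J=\{w: w<_S ws \text{ for all } s\in J\}$ (concretely: $w_i<w_{i+1}$ whenever $s_i\in J$). Writing $J=S\setminus\{s_{j_1},\dots,s_{j_r}\}$ with $j_1<\dots<j_r$, the $J$-regions are the blocks $\{1,\dots,j_1\},\{j_1+1,\dots,j_2\},\dots,\{j_r+1,\dots,n\}$. An element $w\in\mathfrak{S}_n^J$ is $(J,231)$-avoiding if there are no indices $i<j<k$ in pairwise different $J$-regions with $w_k<w_i<w_j$ and $w_i=w_k+1$; $\mathfrak{S}_n^J(231)$ is the set of such elements. For a set partition $\mathbf P$ of $[n]$, a bump is a pair $(a,b)$, $a<b$, with $a,b$ in the same part and no element $c$ of that part with $a<c<b$. $\mathbf P$ is $J$-noncrossing if: (NC1) no two distinct elements of the same $J$-region lie in the same part; (NC2) whenever two distinct bumps $(i_1,i_2),(j_1,j_2)$ satisfy $i_1<j_1<i_2<j_2$, either $i_1,j_1$ lie in the same $J$-region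 or $i_2,j_1$ lie in the same $J$-region; (NC3) whenever two distinct bumps satisfy $i_1<j_1<j_2<i_2$, then $i_1$ and $j_1$ lie in different $J$-regions. $\mathrm{NC}_n^J$ is the set of $J$-noncrossing partitions. $\mathbf P$ is $J$-nonnesting if (NN1) no two distinct elements of the same $J$-region lie in the same part, and (NN2) there are no two distinct bumps $(i_1,i_2),(j_1,j_2)$ with $i_1<j_1<j_2<i_2$. $\mathrm{NN}_n^J$ is the set of $J$-nonnesting partitions. *)

(* Defs.v *)
From mathcomp Require Import all_boot all_order all_fingroup.
Set Implicit Arguments. Unset Strict Implicit. Unset Printing Implicit Defensive.

(* Conventions: positions 1..n of the paper are the ordinals 0..n-1 ('I_n);
   permutations w : 'S_n, with w_i the value (w i) (values also shifted by 1,
   which is harmless for all conditions below).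
   The simple reflection s_i (1 <= i <= n-1) is encoded by the ordinal
   k = i-1 : 'I_n.-1; J : {set 'I_n.-1} is a subset of S.
   s_{k+1} swaps (0-indexed) positions k and k+1. *)

Section JDefs.
Variable n : nat.
Variable J : {set 'I_n.-1}.

(* positions p, q (0-indexed) lie in the same J-region iff every simple
   reflection between them belongs to J *)
Definition sameReg (p q : nat) : bool :=
  [forall k : 'I_n.-1, ((minn p q <= k) && (k < maxn p q)) ==> (k \in J)].

Definition inJ (k : nat) : bool := [exists k' : 'I_n.-1, (val k' == k) && (k' \in J)].

Definition SJ : {set 'S_n} :=
  [set w : 'S_n | [forall i : 'I_n, forall j : 'I_n,
     ((val j == (val i).+1) && inJ i) ==> (val (w i) < val (w j))]].

Definition avoid231 (w : 'S_n) : bool :=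
  ~~ [exists i : 'I_n, exists j : 'I_n, exists k : 'I_n,
       [&& i < j, j < k, ~~ sameReg i j, ~~ sameReg j k, ~~ sameReg i k,
           val (w k) < val (w i), val (w i) < val (w j) &
           val (w i) == (val (w k)).+1]].

Definition SJ231 : {set 'S_n} := [set w in SJ | avoid231 w].

Definition setpart (P : {set {set 'I_n}}) : bool := partition P [set: 'I_n].

Definition bump (P : {set {set 'I_n}}) (a b : 'I_n) : bool :=
  [exists B in P, [&& a \in B, b \in B, a < b &
                     [forall c in B, ~~ ((a < c) && (c < b))]]].

Definition cond1 (P : {set {set 'I_n}}) : bool :=
  [forall B in P, forall a in B, forall b in B, (a != b) ==> ~~ sameReg a b].

Definition NC2 (P : {set {set 'I_n}}) : bool :=
  [forall i1 : 'I_n, forall i2 : 'I_n, forall j1 : 'I_n, forall j2 : 'I_n,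
    [&& bump P i1 i2, bump P j1 j2, (i1, i2) != (j1, j2),
        i1 < j1, j1 < i2 & i2 < j2] ==> (sameReg i1 j1 || sameReg i2 j1)].

Definition NC3 (P : {set {set 'I_n}}) : bool :=
  [forall i1 : 'I_n, forall i2 : 'I_n, forall j1 : 'I_n, forall j2 : 'I_n,
    [&& bump P i1 i2, bump P j1 j2, (i1, i2) != (j1, j2),
        i1 < j1, j1 < j2 & j2 < i2] ==> ~~ sameReg i1 j1].

Definition NN2 (P : {set {set 'I_n}}) : bool :=
  ~~ [exists i1 : 'I_n, exists i2 : 'I_n, exists j1 : 'I_n, exists j2 : 'I_n,
    [&& bump P i1 i2, bump P j1 j2, (i1, i2) != (j1, j2),
        i1 < j1, j1 < j2 & j2 < i2]].

Definition NCJ : {set {set {set 'I_n}}} :=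
  [set P | [&& setpart P, cond1 P, NC2 P & NC3 P]].

Definition NNJ : {set {set {set 'I_n}}} :=
  [set P | [&& setpart P, cond1 P & NN2 P]].

End JDefs.

(* Main.v *)
Require Import Defs.
From mathcomp Require Import all_boot all_order all_fingroup zify.
Set Implicit Arguments. Unset Strict Implicit. Unset Printing Implicit Defensive.

(** Let [rg k] be the first position of the region of [k]. All three sets are
    equinumerous with the weakly increasing functions [h] with [h k <= rg k].

    Permutations: let [h k] count the positions [i] for which some [j <= k] in a
    later region has [w_i < w_j]. When the positions are inserted one after the
    other, avoidance forces the value at [k] to be the maximum or to lie
    immediately below that of a position not counted by [h k]; the number [h k]
    says which one.

    Partitions: record the set [A] of left ends and the set [B] of right ends of
    the bumps. Given the pair, the nonnesting partition matches each right end,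
    from left to right, with the first unmatched left end of an earlier region;
    the noncrossing one does the same, except that left ends in later regions have
    priority. For any priority such greedy matchings correspond to the pairs with
    [#|A| = #|B|] in which every prefix of [B] up to [k] is at most as large as the
    part of [A] before [rg k]. These are the pairs (values of [h] minus 1, jumps of
    [h]) of the functions [h] above. *)

(** * Cardinalities and counting in lists *)

Lemma card_eq_of_bij_on (T1 T2 : finType) (S1 : {set T1}) (S2 : {set T2})
    (f : T1 -> T2) :
  {in S1 &, injective f} -> (forall x, x \in S1 -> f x \in S2) ->
  (forall y, y \in S2 -> exists2 x, x \in S1 & f x = y) -> #|S1| = #|S2|.
Proof.
move=> f_inj f_in f_surj; rewrite -(card_in_imset f_inj).
congr #|pred_of_set _|; apply/setP => y; apply/imsetP/idP => [[x xS ->]|/f_surj[x xS <-]].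
  exact: f_in.
by exists x.
Qed.

Lemma bijective_of_card_eq (T1 T2 : finType) (S1 : {set T1}) (S2 : {set T2}) :
  #|S1| = #|S2| ->
  exists f : {x : T1 | x \in S1} -> {y : T2 | y \in S2}, bijective f.
Proof.
move=> eqS.
have e : #|{: {x : T1 | x \in S1}}| = #|{: {y : T2 | y \in S2}}|.
  by rewrite !card_sig !(eq_card (B := mem _) (fun=> erefl)).
exists (fun x => enum_val (cast_ord e (enum_rank x))).
exists (fun y => enum_val (cast_ord (esym e) (enum_rank y))) => x.
  by rewrite enum_valK cast_ordK enum_rankK.
by rewrite enum_valK cast_ordKV enum_rankK.
Qed.

Lemma sub_in_count (T : eqType) (p q : pred T) (s : seq T) :
  {in s, forall x, p x -> q x} -> count p s <= count q s.
Proof.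
move=> pq; rewrite (eq_in_count (a2 := predI p q)).
  by apply: sub_count => x /andP[].
by move=> x /pq /= pqx; case: (p x) pqx => // ->.
Qed.

Lemma count_sub_eq (T : eqType) (p q : pred T) (s : seq T) :
  {in s, forall x, p x -> q x} -> count p s = count q s -> {in s, p =1 q}.
Proof.
elim: s => [|y s IH] //= pq e x.
have pqs : {in s, forall x, p x -> q x} by move=> z zs; apply: pq; rewrite inE zs orbT.
have les := sub_in_count pqs.
have pqy := pq y (mem_head y s).
have [ep es] : p y = q y /\ count p s = count q s.
  by move: (p y) (q y) pqy e les => [] [] // h; try (by have := h isT); lia.
by rewrite inE => /orP[/eqP->//|]; apply: IH.
Qed.

Lemma count_ltn_iota (r n : nat) : r <= n -> count (fun i => i < r) (iota 0 n) = r.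
Proof.
move=> rn; rewrite -(subnKC rn) iotaD count_cat.
rewrite (eq_in_count (a2 := predT)); last by move=> i; rewrite mem_iota add0n => /andP[_ ->].
rewrite count_predT size_iota (eq_in_count (a2 := pred0)) ?count_pred0 ?addn0 //.
by move=> i; rewrite mem_iota add0n /= => /andP[ri _]; rewrite ltnNge ri.
Qed.

(** The arguments on orders and matchings use only these two properties of the regions. The second
    makes [i < rg k] a test for [i] lying in an earlier region than [k]. *)
Definition region_start (rg : nat -> nat) : Prop :=
  (forall k, rg k <= k) /\ (forall i k, (i < rg k) = (rg i < rg k)).

(** * Avoiding orders *)

Section Regions.

Variable rg : nat -> nat.
Hypothesis rgP : region_start rg.

Let rg_le k : rg k <= k. Proof. by case: rgP. Qed.
Let rg_lt i k : (i < rg k) = (rg i < rg k). Proof. by case: rgP. Qed.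

Lemma rg_mono i k : i <= k -> rg i <= rg k.
Proof. by have := rg_lt k i; have := rg_le i; lia. Qed.

Lemma rg_ltn i k : rg i < rg k -> i < k.
Proof. by rewrite -rg_lt => /leq_trans; apply. Qed.

(* The order [u] restricted to the positions below [m] is increasing on regions
   and [(J,231)]-avoiding; consecutiveness of values is expressed by the absence
   of an intermediate value, so that the notion only depends on the order. *)
Definition good m (u : nat -> nat) : Prop :=
  [/\ forall i j, i < m -> j < m -> u i = u j -> i = j,
      forall i j, i < j -> j < m -> rg i = rg j -> u i < u j &
      forall i j k, k < m -> rg i < rg j -> rg j < rg k -> u k < u i -> u i < u j ->
        exists2 x, x < m & u k < u x < u i].

(** The only intermediate value might sit at the removed position [m]. Then [i], [j], [m] form a
    pattern too, and avoidance yields a further value between those at [m] and [i], at another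
    position. *)
Lemma good_restrict m u : good m.+1 u -> good m u.
Proof.
case=> inju incu avu; split=> [i j im jm|i j ij jm|i j k km rij rjk uki uij].
- by apply: inju; lia.
- by apply: incu; lia.
have [|x xm /andP[kx xi]] := avu i j k _ rij rjk uki uij; first by lia.
case: (ltngtP x m) => [xm'|?|ex]; [by exists x; rewrite ?kx|lia|subst x].
have rkm : rg j < rg m by have := rg_mono (ltnW km); lia.
have [y ym /andP[my yi]] := avu i j m (leqnn _) rij rkm xi uij.
exists y; last by lia.
have : y != m by apply: contraTneq my => ->; rewrite ltnn.
lia.
Qed.

Lemma good_le m n u : m <= n -> good n u -> good m u.
Proof.
elim: n => [|n IH]; first by rewrite leqn0 => /eqP->.
by rewrite leq_eqVlt => /orP[/eqP->//|mn /good_restrict]; apply: IH.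
Qed.

(** Such an [i] starts a pattern waiting for its last entry: in a good order the value at [m] cannot
    lie immediately below [u i]. *)
Definition dead (u : nat -> nat) m i :=
  has (fun j => (rg i < rg j) && (u i < u j)) (iota 0 m).

Lemma deadP u m i :
  reflect (exists j, [/\ j < m, rg i < rg j & u i < u j]) (dead u m i).
Proof.
apply: (iffP hasP) => [[j]|[j [jm rij uij]]].
  by rewrite mem_iota add0n => /andP[_ jm] /andP[]; exists j.
by exists j; rewrite ?mem_iota ?add0n ?rij.
Qed.

Lemma deadS u m i : dead u m.+1 i = dead u m i || (rg i < rg m) && (u i < u m).
Proof. by rewrite /dead -[m.+1]addn1 iotaD has_cat /= orbF. Qed.

Lemma dead_lt u m i : dead u m.+1 i -> i < rg m.
Proof.
case/deadP=> j [jm rij _]; rewrite rg_lt.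
by apply: leq_trans rij _; apply: rg_mono.
Qed.

Lemma eq_dead u u' m :
  (forall i j, i < m -> j < m -> (u i < u j) = (u' i < u' j)) ->
  dead u m =1 dead u' m.
Proof.
move=> uu' i; apply: eq_in_has => j; rewrite mem_iota add0n => /andP[_ jm].
case: (boolP (rg i < rg j)) => //= /rg_ltn ij; apply: uu' => //; lia.
Qed.

(* The value at [m] sits just below the least value of an undead position:
   avoidance forces the position carrying the next larger value to be undead. *)
Lemma good_gtP m u i : good m.+1 u -> i < m ->
  reflect (exists a, [/\ a < rg m, ~~ dead u m.+1 a & u a <= u i]) (u m < u i).
Proof.
case=> inju incu avu im; apply: (iffP idP) => [umi|[a [arm nda uai]]]; last first.
  rewrite ltnNge; apply/negP => uim.
  have am : a < m by apply: leq_trans arm (rg_le m).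
  case/negP: nda; apply/deadP; exists m; rewrite -rg_lt; split=> //.
  rewrite ltn_neqAle (leq_trans uai uim) andbT; apply/eqP => /inju; lia.
pose p := [pred a : 'I_m | u m < u a].
have pi : p (Ordinal im) by [].
have [a /= pa amin] := arg_minnP (fun a : 'I_m => u a) pi.
have am := ltn_ord a.
have ram : rg a < rg m.
  have := rg_mono (ltnW am); rewrite leq_eqVlt => /orP[/eqP ram|//].
  by have := incu a m am (leqnn _) ram; lia.
exists a; split; [by rewrite rg_lt| |exact: (amin (Ordinal im))].
apply/deadP => -[j [jm raj uaj]].
have jm' : j < m by case: (ltngtP j m) => // [|ej]; [lia|subst j; lia].
have rjm : rg j < rg m.
  have := rg_mono (ltnW jm'); rewrite leq_eqVlt => /orP[/eqP rjm|//].
  by have := incu j m jm' (leqnn _) rjm; lia.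
(* If [a] were dead because of [j], avoidance would give a value between [u m] and [u a], against
   the minimality of [a]. *)
have [x xm /andP[umx uxa]] := avu _ _ _ (leqnn _) raj rjm pa uaj.
have xm' : x < m by case: (ltngtP x m) => // [|ex]; [lia|subst x; lia].
by have := amin (Ordinal xm') umx; rewrite /= leqNgt uxa.
Qed.

Variable n : nat.

(** The range up to [n] serves all [k] alike; by [dead_lt] only positions before [rg k]
    contribute. *)
Definition deadnum u k := count (dead u k.+1) (iota 0 n).

Lemma deadnum_le u k : k < n -> deadnum u k <= rg k.
Proof.
move=> kn; have rn : rg k <= n by have := rg_le k; lia.
by rewrite -[leqRHS](count_ltn_iota rn); apply: sub_count => i /dead_lt.
Qed.

Lemma deadnum_mono u k l : k <= l -> deadnum u k <= deadnum u l.
Proof.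
move=> kl; apply: sub_count => i /deadP[j [jk rij uij]].
by apply/deadP; exists j; split=> //; lia.
Qed.

(** Induction on the number of inserted positions. The new dead sets are comparable by inclusion, so
    equal cardinalities make them equal, and by [good_gtP] the dead set determines where the value
    at [m] goes. *)
Lemma good_order_determined u u' : good n u -> good n u' ->
  (forall k, k < n -> deadnum u k = deadnum u' k) ->
  forall i j, i < n -> j < n -> (u i < u j) = (u' i < u' j).
Proof.
move=> gu gu' eqd; suff : forall m, m <= n ->
    forall i j, i < m -> j < m -> (u i < u j) = (u' i < u' j) by apply.
elim=> [//|m IH] mn; have {}IH := IH (ltnW mn).
have guS := good_le mn gu; have gu'S := good_le mn gu'.
have eq0 := eq_dead IH.
have dd : {in iota 0 n, dead u m.+1 =1 dead u' m.+1}.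
  (* Both dead sets add to a common set an initial segment, for the common order, of the positions
     before [rg m]; hence one contains the other. *)
  have cmp v v' : (forall i j, i < m -> j < m -> (v i < v j) = (v' i < v' j)) ->
      good m.+1 v -> forall i i', dead v m.+1 i -> ~~ dead v' m.+1 i ->
      dead v' m.+1 i' -> dead v m.+1 i'.
    move=> vv' [injv _ _] i i' di ndi di'.
    have im := leq_trans (dead_lt di) (rg_le m).
    have i'm := leq_trans (dead_lt di') (rg_le m).
    move: di ndi di'; rewrite !deadS !(eq_dead vv').
    case: (dead v' m i) => //= /andP[-> vim]; case: (dead v' m i') => //=.
    rewrite -leqNgt => v'im /andP[-> v'i'm] /=.
    have : (v' i' < v' i) by lia.
    by rewrite -vv' //; lia.
  have [sub|/allPn[i iin]] := boolP (all (fun i => dead u m.+1 i ==> dead u' m.+1 i) (iota 0 n)).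
    apply: count_sub_eq; last exact: eqd.
    by move=> i /(allP sub)/implyP.
  rewrite negb_imply => /andP[di ndi] x xin; apply/esym.
  apply: count_sub_eq x xin; last by apply/esym/eqd.
  by move=> x _; apply: cmp di ndi.
have key i : i < m -> (u m < u i) = (u' m < u' i).
  move=> im; apply/(good_gtP guS im)/(good_gtP gu'S im) => -[a [arm nda uai]];
    exists a; have am := leq_trans arm (rg_le m); split=> //.
  - by rewrite -dd // mem_iota; lia.
  - by rewrite leqNgt -IH // -leqNgt.
  - by rewrite dd // mem_iota; lia.
  - by rewrite leqNgt IH // -leqNgt.
case: guS => inju _ _; case: gu'S => inju' _ _.
move=> i j; rewrite !ltnS => im jm.
case: (ltngtP i m) im => // [im _|-> _]; case: (ltngtP j m) jm => // [jm _|-> _].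
- exact: IH.
- have := key i im; have := inju i m; have := inju' i m; lia.
- exact: key.
- by rewrite !ltnn.
Qed.

(** Positions are inserted one by one, each with a value [v] that brings the number of dead
    positions to [h m]. *)
Lemma good_exists h : (forall k, k < n -> h k <= rg k) ->
  (forall k l, k <= l -> l < n -> h k <= h l) ->
  exists u, [/\ good n u, forall i, i < n -> u i < n &
                forall k, k < n -> deadnum u k = h k].
Proof.
move=> hrg hmono; suff : forall m, m <= n -> exists u, [/\ good m u,
    forall i, i < m -> u i < m & forall k, k < m -> deadnum u k = h k] by apply.
elim=> [|m IH] mn; first by exists id.
have [u [[inju incu avu] ranu hu]] := IH (ltnW mn).
(* [F t] is the number of dead positions if the new value is [t]. It starts at or below [h m], grows
   by at most one per step and ends at [rg m], which is at least [h m]. *)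
pose F t := count (fun i => dead u m i || (i < rg m) && (u i < t)) (iota 0 n).
have F0 : F 0 <= h m.
  rewrite /F (eq_count (a2 := dead u m)); last by move=> i; rewrite ltn0 andbF orbF.
  case: (posnP m) => [->|m0]; first by rewrite (eq_count (a2 := pred0)) ?count_pred0.
  have -> : m = m.-1.+1 by lia.
  rewrite -/(deadnum _ _) hu; last lia.
  by apply: hmono; lia.
have FS t : F t.+1 <= (F t).+1.
  rewrite /F; set p := fun i => dead u m i || (i < rg m) && (u i < t).
  apply: (@leq_trans (count (predU p (fun i => (i < m) && (u i == t))) (iota 0 n))).
    apply: sub_count => i /=; rewrite /p /= => /orP[->//|/andP[irm uit]].
    have := leq_trans irm (rg_le m); rewrite irm; case: (dead _ _ _) => //=; lia.
  rewrite -addn1; have := count_predUI p (fun i => (i < m) && (u i == t)) (iota 0 n).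
  have : count (fun i => (i < m) && (u i == t)) (iota 0 n) <= 1; last by lia.
  rewrite -size_filter; set s := filter _ _.
  have us : uniq s by rewrite filter_uniq ?iota_uniq.
  case es: s us => [|a [|b s']] //= /andP[]; rewrite inE negb_or => /andP[/eqP ab _] _.
  case: ab; have [] : a \in s /\ b \in s by rewrite es !inE !eqxx ?orbT.
  by rewrite !mem_filter => /andP[/andP[am /eqP ua] _] /andP[/andP[bm /eqP ub] _]; apply: inju => //; rewrite ua.
have Fm : F m = rg m.
  have rn : rg m <= n by have := rg_le m; lia.
  rewrite -[RHS](count_ltn_iota rn); apply: eq_count => i.
  apply/idP/idP => [/orP[|/andP[]//]|irm]; last first.
    by rewrite irm ranu ?orbT //; apply: leq_trans irm (rg_le m).
  by case/deadP=> j [jm rij _]; rewrite rg_lt (leq_trans rij) // rg_mono // ltnW.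
(* The largest [t] with [F t <= h m] gives equality. If it is below [m], then [F] increases right
   after it, so the old value [v] belongs to an undead position before [rg m]. *)
have [v [vm Fv vi]] : exists v, [/\ v <= m, F v = h m &
    v < m -> exists i, [/\ i < rg m, ~~ dead u m i & u i = v]].
  have ex0 : exists t, (t <= m) && (F t <= h m) by exists 0; rewrite F0.
  have bnd t : (t <= m) && (F t <= h m) -> t <= m by case/andP.
  case: (ex_maxnP ex0 bnd) => v /andP[vm Fvh] vmax; exists v.
  have [evm|ltvm] : v = m \/ v < m by lia.
    by split=> //; [have := hrg _ mn; rewrite evm in Fvh *; lia|lia].
  have FvS : h m < F v.+1.
    by rewrite ltnNge; apply/negP => le; have := vmax v.+1; rewrite ltvm le; lia.
  have Fv := FS v; split=> //; first lia.
  move=> _; case: (boolP (has (fun i => [&& i < rg m, ~~ dead u m i & u i == v]) (iota 0 n))).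
    by case/hasP=> i _ /and3P[? ? /eqP ?]; exists i.
  move/hasPn=> none; suff : F v.+1 <= F v by lia.
  apply: sub_in_count => i /none.
  by case: (dead u m i) => //=; case: (i < rg m) => //=; lia.
(* Old values from [v] on move up by one to make room for [v] at [m]. *)
pose u' x := if x == m then v else u x + (v <= u x).
have u'm : u' m = v by rewrite /u' eqxx.
have u'E x : x < m -> u' x = u x + (v <= u x) by move=> xm; rewrite /u' ltn_eqF.
have u'lt x y : x < m -> y < m -> (u x < u y) = (u' x < u' y).
  by move=> xm ym; rewrite !u'E //; lia.
exists u'; split; [split| |].
- move=> i j; rewrite !ltnS => im jm.
  case: (ltngtP i m) im => // [im _|-> _]; case: (ltngtP j m) jm => // jm _;
    rewrite ?jm ?u'm ?u'E //; try lia.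
  by move=> e; apply: inju => //; lia.
- move=> i j ij; rewrite ltnS; case: (ltngtP j m) => // [jm _|ej _] rij.
    by rewrite -u'lt ?incu //; lia.
  subst j; rewrite u'm u'E //; suff : u i < v by lia.
  case: (ltngtP v m) vi vm => // [_ /(_ isT)[a [arm nda uav]] _|-> _ _]; last exact: ranu.
  case: (ltngtP (u i) v) => // [vui|uiv].
    case/negP: nda; apply/deadP; exists i; rewrite rij -rg_lt uav; split=> //.
  have := leq_trans arm (rg_le m) => am.
  have ai : a = i by apply: inju => //; rewrite uav.
  by have := rg_le i; lia.
- move=> i j k; rewrite ltnS => km rij rjk.
  have jk := rg_ltn rjk; have ij := rg_ltn rij.
  case: (ltngtP k m) km => // [km _|ek _].
    rewrite -!u'lt; try lia.
    move=> uki uij; have [x xm hx] := avu _ _ _ km rij rjk uki uij.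
    by exists x; rewrite -?u'lt //; lia.
  subst k; rewrite u'm !u'E; try lia.
  move=> vi' uij; have vui : v <= u i by lia.
  have uij' : u i < u j by lia.
  have [|a [arm nda uav]] := vi; first by have := ranu i; lia.
  have am := leq_trans arm (rg_le m).
  (* The position [a] that carried [v] now has the value just above [v] and is the intermediate one;
     it differs from [i], which [j] makes dead. *)
  exists a; first lia.
  rewrite u'E // uav leqnn; case: (ltngtP v (u i)) vui => // [|eqv _]; first lia.
  have ai : a = i by apply: inju; lia.
  case/negP: nda; apply/deadP; exists j; rewrite ai; split=> //; lia.
- move=> i; rewrite !ltnS; case: (ltngtP i m) => // [im _|-> _]; last by rewrite u'm.
  by rewrite u'E //; have := ranu i im; lia.
- move=> k; rewrite ltnS; case: (ltngtP k m) => // [km _|-> _].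
    rewrite -hu //; apply: eq_count => i; apply/esym.
    by apply: eq_dead => x y xk yk; apply: u'lt; lia.
  rewrite -Fv; apply: eq_in_count => i _.
  rewrite deadS -(eq_dead u'lt) -rg_lt u'm; congr (_ || _).
  case: (boolP (i < rg m)) => //= irm; rewrite u'E; first lia.
  exact: leq_trans irm (rg_le m).
Qed.

End Regions.

(** * Counting functions of predicates on [nat] *)

Definition cnt (X : pred nat) m := count X (iota 0 m).

Lemma cntS X m : cnt X m.+1 = cnt X m + X m.
Proof. by rewrite /cnt -[m.+1]addn1 iotaD count_cat /= addn0. Qed.

Lemma cnt_mono X p q : p <= q -> cnt X p <= cnt X q.
Proof. by move=> pq; rewrite -(subnKC pq) /cnt iotaD count_cat leq_addr. Qed.

Lemma eq_cnt X Y m : (forall x, x < m -> X x = Y x) -> cnt X m = cnt Y m.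
Proof. by move=> XY; apply: eq_in_count => x; rewrite mem_iota add0n => /XY. Qed.

Lemma cnt_gap X p q : p <= q -> (forall x, p <= x < q -> ~~ X x) -> cnt X q = cnt X p.
Proof.
move=> pq gap; rewrite -(subnKC pq) /cnt iotaD count_cat add0n.
rewrite (@eq_in_count _ X pred0 (iota p _)) ?count_pred0 ?addn0 // => x.
by rewrite mem_iota subnKC // => /gap/negbTE.
Qed.

(** The side conditions make each argument the least one with its count. *)
Lemma cnt_inj X x y : cnt X x = cnt X y ->
  (x = 0 \/ X x.-1) -> (y = 0 \/ X y.-1) -> x = y.
Proof.
have half a b : cnt X a = cnt X b -> (b = 0 \/ X b.-1) -> b <= a.
  case: b => [//|b] e [//|/= Xb]; rewrite leqNgt; apply/negP => ab.
  by have := @cnt_mono X a b; rewrite e cntS Xb; lia.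
by move=> e ex ey; apply/eqP; rewrite eqn_leq !half.
Qed.

Lemma cnt_onto X m c : 0 < c <= cnt X m -> exists k, [/\ k < m, X k & cnt X k.+1 = c].
Proof.
elim: m => [|m IH]; first by rewrite /cnt /=; lia.
rewrite cntS; have [le|gt] := leqP c (cnt X m).
  by move=> cpos; have [|k [km Xk e]] := IH; [lia|exists k; split=> //; lia].
move=> cle; have Xm : X m by case: (X m) cle => //; lia.
by exists m; split=> //; rewrite cntS Xm in cle *; lia.
Qed.

Lemma cnt_le_rel (X Y : pred nat) M N (r : rel nat) :
  (forall a, a < M -> X a -> exists b, [/\ b < N, Y b & r a b]) ->
  (forall a a' b, r a b -> r a' b -> a = a') -> cnt X M <= cnt Y N.
Proof.
move=> ex r_inj; pose p a b := Y b && r a b.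
pose f a := find (p a) (iota 0 N).
have fP a : a \in filter X (iota 0 M) -> [/\ f a < N, Y (f a) & r a (f a)].
  rewrite mem_filter mem_iota add0n => /andP[Xa /andP[_ aM]].
  have [b [bN Yb rab]] := ex a aM Xa.
  have hasp : has (p a) (iota 0 N) by apply/hasP; exists b; rewrite ?mem_iota // /p Yb.
  have fN : f a < N by rewrite -[X in _ < X](size_iota 0 N) -has_find.
  by have := nth_find 0 hasp; rewrite nth_iota // add0n => /andP[].
rewrite /cnt -!size_filter -(size_map f); apply: uniq_leq_size.
  rewrite map_inj_in_uniq ?filter_uniq ?iota_uniq //.
  by move=> a a' /fP[_ _ ra] /fP[_ _ ra'] e; apply: r_inj ra _; rewrite e.
move=> _ /mapP[a /fP[fN Yf _] ->].
by rewrite mem_filter Yf mem_iota add0n fN.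
Qed.

(** * Lattice paths and ballot pairs *)

Section Ballot.

Variables (rg : nat -> nat) (n : nat).
Hypothesis rgP : region_start rg.

Let rg_le k : rg k <= k. Proof. by case: rgP. Qed.

Definition bounded_mono (h : nat -> nat) : Prop :=
  (forall k, k < n -> h k <= rg k) /\ (forall k l, k <= l -> l < n -> h k <= h l).

Definition ballot (A B : pred nat) : Prop :=
  cnt A n = cnt B n /\ forall k, k < n -> cnt B k.+1 <= cnt A (rg k).

(** The default 0 is the height of a path before its first position. *)
Definition prev (h : nat -> nat) k := if k is k'.+1 then h k' else 0.
Definition heights (h : nat -> nat) : pred nat :=
  fun a => has (fun k => h k == a.+1) (iota 0 n).
Definition jumps (h : nat -> nat) : pred nat := fun k => prev h k < h k.

Lemma heightsP h a : reflect (exists2 k, k < n & h k = a.+1) (heights h a).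
Proof.
apply: (iffP hasP) => [[k]|[k kn e]]; last by exists k; rewrite ?e ?mem_iota.
by rewrite mem_iota add0n => /andP[_ kn] /eqP; exists k.
Qed.

Lemma heights_pred h k : k < n -> h k = 0 \/ heights h (h k).-1.
Proof.
by move=> kn; case e : (h k) => [|a]; [left|right; apply/heightsP; exists k].
Qed.

(** By monotonicity each jump contributes exactly one new positive height, as values strictly
    between two consecutive ones are never taken. *)
Lemma cnt_jumps h k : bounded_mono h -> k < n ->
  cnt (jumps h) k.+1 = cnt (heights h) (h k).
Proof.
move=> [hrg hmono]; elim: k => [|k IH] kn.
  have h0 : h 0 = 0 by have := hrg _ kn; have := rg_le 0; lia.
  by rewrite cntS /jumps /= h0.
rewrite cntS IH; last lia.
have := hmono k k.+1 (leqnSn _) kn; rewrite leq_eqVlt /jumps /=.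
case/orP=> [/eqP->|lt]; first by rewrite ltnn addn0.
rewrite lt; have hpos : h k.+1 = (h k.+1).-1.+1 by lia.
have := heights_pred h kn; rewrite hpos cntS /= => -[//|->]; congr (_ + _).
apply/esym; apply: cnt_gap; first lia.
move=> x /andP[hx xh]; apply/heightsP => -[l ln hl].
case: (leqP l k) => lk; first by have := hmono l k lk; lia.
by have := hmono _ _ lk ln; lia.
Qed.

Lemma ballot_heights_jumps h : 0 < n -> bounded_mono h -> ballot (heights h) (jumps h).
Proof.
move=> n0 hb; have [hrg hmono] := hb; split=> [|k kn]; last first.
  by rewrite cnt_jumps //; apply: cnt_mono; apply: hrg.
have en : n = n.-1.+1 by lia.
have ln : n.-1 < n by lia.
rewrite [in RHS]en cnt_jumps //.
apply: cnt_gap; first by have := hrg _ ln; have := rg_le n.-1; lia.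
move=> x /andP[hx xn]; apply/heightsP => -[l lln hl].
by have := hmono l n.-1; lia.
Qed.

Lemma heights_lt h a : bounded_mono h -> heights h a -> a < n.
Proof.
case=> hrg _ /heightsP[k kn e]; have := hrg k kn; have := rg_le k; lia.
Qed.

(** By [cnt_jumps], [h k] is the least [x] with as many elements of [heights h] below it as there
    are jumps up to [k]. *)
Lemma heights_jumps_inj h h' : bounded_mono h -> bounded_mono h' ->
  (forall a, a < n -> heights h a = heights h' a) ->
  (forall k, k < n -> jumps h k = jumps h' k) -> forall k, k < n -> h k = h' k.
Proof.
move=> hb hb' eA eB k kn.
have {}eA a : heights h a = heights h' a.
  case: (ltnP a n) => [/eA//|na]; apply/idP/idP.
    by move/(heights_lt hb); lia.
  by move/(heights_lt hb'); lia.
apply: (@cnt_inj (heights h)); first last.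
- by rewrite eA; apply: heights_pred.
- exact: heights_pred.
rewrite -cnt_jumps // (eq_cnt (Y := jumps h')); last by move=> x xk; apply: eB; lia.
by rewrite cnt_jumps //; apply: eq_cnt => x _; rewrite eA.
Qed.

(** The inverse sends [k] to the least [x] such that [A] has at least as many elements below [x] as
    [B] has up to [k]; the ballot condition bounds it by [rg k]. *)
Lemma heights_jumps_surj A B : ballot A B ->
  exists h, [/\ bounded_mono h, forall a, a < n -> heights h a = A a &
                forall k, k < n -> jumps h k = B k].
Proof.
move=> [eAB bal].
pose p k x := cnt B k.+1 <= cnt A x.
pose h k := find (p k) (iota 0 n.+1).
have hmin k x : x <= n -> p k x -> h k <= x.
  move=> xn pkx; rewrite leqNgt; apply/negP => lt.
  by have := before_find 0 lt; rewrite nth_iota ?add0n // ?pkx //; lia.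
have hp k : k < n -> p k (h k).
  move=> kn; have hasp : has (p k) (iota 0 n.+1).
    apply/hasP; exists (rg k); last exact: bal.
    by rewrite mem_iota; have := rg_le k; lia.
  have hn : h k < n.+1 by rewrite -[X in _ < X](size_iota 0 n.+1) -has_find.
  by have := nth_find 0 hasp; rewrite nth_iota.
have hrg k : k < n -> h k <= rg k.
  by move=> kn; apply: hmin; [have := rg_le k; lia|exact: bal].
(* Minimality turns the inequality into an equality and puts an element of [A] just before a nonzero
   [h k], as [cnt_inj] requires. *)
have hspec k : k < n -> cnt A (h k) = cnt B k.+1 /\ (h k = 0 \/ A (h k).-1).
  move=> kn; have := hp k kn; have := hrg k kn; have := rg_le k; rewrite /p.
  case e : (h k) => [|x] hk rk; first by rewrite /cnt /= leqn0 => /eqP->; split; [|left].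
  have := hmin k x; rewrite /p e (cntS A) => hx le.
  have xn : x <= n by lia.
  have lt : cnt A x < cnt B k.+1 by rewrite ltnNge; apply/negP => /(hx xn); rewrite ltnn.
  have Ax : A x by apply: contraLR lt => /negbTE Ax; rewrite Ax addn0 in le; rewrite -leqNgt.
  by rewrite Ax in le *; split; [lia|right].
have hmono k l : k <= l -> l < n -> h k <= h l.
  move=> kl ln; apply: hmin; first by have := hrg l ln; have := rg_le l; lia.
  by rewrite /p; apply: leq_trans (hp l ln); apply: cnt_mono.
exists h; split=> // [a an|k kn].
- apply/heightsP/idP => [[k kn e]|Aa].
    by have [_] := hspec k kn; rewrite e => -[].
  have [|k [kn _ e]] := @cnt_onto B n (cnt A a.+1).
    by rewrite -eAB {1}cntS Aa addn1 /=; apply: cnt_mono.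
  exists k => //; have [eA hA] := hspec k kn.
  by apply: (@cnt_inj A) => //; [rewrite eA|right].
- have [eA hA] := hspec k kn.
  have [eP hP] : cnt A (prev h k) = cnt B k /\ (prev h k = 0 \/ A (prev h k).-1).
    by case: k kn {eA hA} => [|k] kn; [split; [|left]|apply: hspec; lia].
  rewrite /jumps; move: eA; rewrite cntS.
  case: (B k) => eA.
    by rewrite ltnNge; apply/negP => /(@cnt_mono A); lia.
  by rewrite (@cnt_inj A (h k) (prev h k)) ?ltnn //; lia.
Qed.

End Ballot.

(** * Greedy matchings *)

(* Set partitions of an initial segment of [nat] are given by labellings [c];
   [arc c a b] says that [(a, b)] is a bump of the partition into fibres. *)
Definition arc (c : nat -> nat) a b :=
  [&& a < b, c a == c b & ~~ has (fun x => c x == c a) (iota a.+1 (b - a.+1))].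

Lemma arcP c a b :
  reflect [/\ a < b, c a = c b & forall x, a < x < b -> c x <> c a] (arc c a b).
Proof.
apply: (iffP and3P) => [[ab /eqP e /hasPn no]|[ab e no]]; split=> //.
- by move=> x axb; apply/eqP/no; rewrite mem_iota; lia.
- exact/eqP.
- by apply/hasPn => x; rewrite mem_iota => axb; apply/eqP/no; lia.
Qed.

Lemma arc_lt c a b : arc c a b -> a < b. Proof. by case/and3P. Qed.

Lemma arc_closer_uniq c a b b' : arc c a b -> arc c a b' -> b = b'.
Proof.
move=> /arcP[ab e no] /arcP[ab' e' no'].
case: (ltngtP b b') => // lt; [case: (no' b)|case: (no b')]; rewrite ?ab ?ab' //; congruence.
Qed.

Lemma arc_opener_uniq c a a' b : arc c a b -> arc c a' b -> a = a'.
Proof.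
move=> /arcP[ab e no] /arcP[a'b e' no'].
case: (ltngtP a a') => // lt; [case: (no a')|case: (no' a)]; rewrite ?lt ?ab ?a'b //; congruence.
Qed.

Lemma eq_arc c c' a b :
  (forall x y, x <= b -> y <= b -> (c x == c y) = (c' x == c' y)) -> arc c a b = arc c' a b.
Proof.
move=> cc'; rewrite /arc; case: (ltnP a b) => //= ab; rewrite cc' //; last lia.
congr (_ && ~~ _); apply: eq_in_has => x; rewrite mem_iota => axb.
by apply: cc'; lia.
Qed.

Lemma arc_exists c a b : a < b -> c a = c b -> exists2 x, arc c a x & x <= b.
Proof.
move=> ab e; have ex : exists x, (a < x) && (c x == c a) by exists b; rewrite ab e eqxx.
case: (ex_minnP ex) => x /andP[ax /eqP cx] xmin; exists x.
  apply/arcP; split=> // y /andP[ay yx] cy.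
  by have := xmin y; rewrite ay cy eqxx; lia.
by apply: xmin; rewrite ab e eqxx.
Qed.

(** Points with the same label are linked by successive arcs; the first one is split off in an
    induction on the distance. *)
Lemma arc_chain c (r : nat -> nat -> Prop) n :
  (forall x y z, r x y -> r y z -> r x z) ->
  (forall a b, b < n -> arc c a b -> r a b) ->
  forall a b, a < b -> b < n -> c a = c b -> r a b.
Proof.
move=> r_tr r_arc a b; have [m] := ubnP (b - a); elim: m a b => // m IH a b bam ab bn e.
have [x ax xb] := arc_exists ab e; have [ltax ex _] := arcP _ _ _ ax.
case: (ltngtP x b) xb => // [xb _|exb _]; last by subst x; apply: r_arc.
apply: (r_tr _ x); first by apply: r_arc => //; lia.
by apply: IH => //; [lia|congruence].
Qed.

Section Greedy.

Variables (rg : nat -> nat) (n : nat) (key : nat -> nat).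
Hypothesis rgP : region_start rg.
Hypothesis key_inj : forall a a', a < n -> a' < n -> key a = key a' -> a = a'.

Let rg_le k : rg k <= k. Proof. by case: rgP. Qed.
Let rg_lt i k : (i < rg k) = (rg i < rg k). Proof. by case: rgP. Qed.

(* Scanning from left to right, every closer is matched with the opener of
   least key among the unmatched ones of earlier regions. *)
Definition greedy (c : nat -> nat) : Prop :=
  (forall a b, b < n -> arc c a b -> rg a < rg b) /\
  (forall a1 b1 a2 b2, b1 < b2 -> b2 < n -> arc c a1 b1 -> arc c a2 b2 ->
     rg a2 < rg b1 -> key a1 < key a2).

(** Labels from [n] on have no meaning, so only arcs ending below [n] count. *)
Definition openers c : pred nat := fun a => has (arc c a) (iota 0 n).
Definition closers c : pred nat := fun b => has (fun a => arc c a b) (iota 0 b).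

Lemma openersP c a : reflect (exists2 b, b < n & arc c a b) (openers c a).
Proof.
apply: (iffP hasP) => [[b]|[b bn ab]]; last by exists b; rewrite ?mem_iota.
by rewrite mem_iota add0n => /andP[_ bn]; exists b.
Qed.

Lemma closersP c b : reflect (exists a, arc c a b) (closers c b).
Proof.
apply: (iffP hasP) => [[a _]|[a ab]]; first by exists a.
by exists a; rewrite ?mem_iota ?add0n ?(arc_lt ab).
Qed.

(** Arcs match openers and closers one to one, and a closer up to [k] has its opener in an earlier
    region, hence before [rg k]. *)
Lemma greedy_ballot c : greedy c -> ballot rg n (openers c) (closers c).
Proof.
case=> rgc _; split=> [|k kn].
  apply/eqP; rewrite eqn_leq; apply/andP; split.
    apply: (@cnt_le_rel _ _ _ _ (arc c)) => [a an /openersP[b bn ab]|a a' b].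
      by exists b; split=> //; apply/closersP; exists a.
    exact: arc_opener_uniq.
  apply: (@cnt_le_rel _ _ _ _ (fun b a => arc c a b)) => [b bn /closersP[a ab]|b b' a].
    exists a; split=> //; first by have := arc_lt ab; lia.
    by apply/openersP; exists b.
  exact: arc_closer_uniq.
apply: (@cnt_le_rel _ _ _ _ (fun b a => arc c a b)) => [b bk /closersP[a ab]|b b' a].
  have bn : b < n by lia.
  exists a; split=> //; last by apply/openersP; exists b.
  by rewrite rg_lt (leq_trans (rgc _ _ bn ab)) // rg_mono.
exact: arc_closer_uniq.
Qed.

(** Induction on the closer: two greedy matchings that agree before [b] must both give [b] the
    available opener of least key. *)
Lemma greedy_arcs_uniq c c' : greedy c -> greedy c' ->
  (forall a, a < n -> openers c a = openers c' a) ->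
  (forall b, b < n -> closers c b = closers c' b) ->
  forall a b, b < n -> arc c a b = arc c' a b.
Proof.
move=> gc gc' eo ec a b; move: b a; elim/ltn_ind => b IH a bn.
(* In [c1] the opener [a2] has some closer: an earlier one contradicts the agreement so far, a later
   one greediness, and [b] itself the uniqueness of the opener. *)
have no_better c1 c2 a1 a2 : greedy c1 -> greedy c2 ->
    (forall a, a < n -> openers c1 a = openers c2 a) ->
    (forall b', b' < b -> forall a, b' < n -> arc c1 a b' = arc c2 a b') ->
    arc c1 a1 b -> arc c2 a2 b -> key a2 < key a1 -> False.
  move=> [rg1 g1] [rg2 g2] eo12 IH12 arc1 arc2 lt.
  have a2n := arc_lt arc2.
  have : openers c1 a2 by rewrite eo12; [apply/openersP; exists b|lia].
  case/openersP=> b2 b2n arc12; case: (ltngtP b2 b) => [b2b|bb2|eb].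
  - rewrite IH12 // in arc12; have := arc_closer_uniq arc12 arc2; lia.
  - by have := g1 _ _ _ _ bb2 b2n arc1 arc12 (rg2 _ _ bn arc2); lia.
  - by subst b2; have := arc_opener_uniq arc12 arc1 => e; rewrite e ltnn in lt.
have main c1 c2 : greedy c1 -> greedy c2 ->
    (forall a, a < n -> openers c1 a = openers c2 a) ->
    (forall b, b < n -> closers c1 b = closers c2 b) ->
    (forall b', b' < b -> forall a, b' < n -> arc c1 a b' = arc c2 a b') ->
    arc c1 a b -> arc c2 a b.
  move=> g1 g2 eo12 ec12 IH12 arc1.
  have : closers c2 b by rewrite -ec12 //; apply/closersP; exists a.
  case/closersP=> a2 arc2; case: (ltngtP (key a2) (key a)) => lt.
  - by case: (no_better _ _ _ _ g1 g2 eo12 IH12 arc1 arc2 lt).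
  - case: (no_better _ _ _ _ g2 g1 _ _ arc2 arc1 lt) => [x xn|x xb y xn]; first by rewrite eo12.
    by rewrite IH12.
  - have -> : a = a2 => //.
    by apply/esym; apply: key_inj lt; have := arc_lt arc1; have := arc_lt arc2; lia.
apply/idP/idP; apply: main => // [x xn|x xn|x xb y xn].
- by rewrite eo.
- by rewrite ec.
- by rewrite IH.
Qed.

(* The last clause of the invariant also covers the openers in [A] that are
   still unmatched, which is what makes the induction work. *)
Lemma greedy_exists A B : ballot rg n A B ->
  exists c, [/\ greedy c, forall a, a < n -> openers c a = A a &
                forall b, b < n -> closers c b = B b].
Proof.
move=> [eAB bal].
have [c [_ arcAB arcB opt]] : exists c, [/\ forall x, x < n -> c x <= x,
    forall a b, b < n -> arc c a b -> [/\ A a, B b & rg a < rg b],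
    forall b, b < n -> B b -> exists a, arc c a b &
    forall a1 b1 a2, b1 < n -> arc c a1 b1 -> A a2 -> rg a2 < rg b1 ->
      key a2 < key a1 -> exists2 b2, b2 < b1 & arc c a2 b2].
  suff : forall m, m <= n -> exists c, [/\ forall x, x < m -> c x <= x,
    forall a b, b < m -> arc c a b -> [/\ A a, B b & rg a < rg b],
    forall b, b < m -> B b -> exists a, arc c a b &
    forall a1 b1 a2, b1 < m -> arc c a1 b1 -> A a2 -> rg a2 < rg b1 ->
      key a2 < key a1 -> exists2 b2, b2 < b1 & arc c a2 b2] by apply.
  elim=> [|m IH] mn; first by exists id.
  have [c [cle arcAB arcB opt]] := IH (ltnW mn).
  (* Labelling [m] does not change the arcs ending before [m], so only those ending at [m] need
     checking. *)
  have extend l : l <= m -> let c' := fun x => if x == m then l else c x in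
      (forall a, arc c' a m -> [/\ A a, B m & rg a < rg m]) ->
      (B m -> exists a, arc c' a m) ->
      (forall a1 a2, arc c' a1 m -> A a2 -> rg a2 < rg m ->
        key a2 < key a1 -> exists2 b2, b2 < m & arc c a2 b2) ->
      exists c, [/\ forall x, x < m.+1 -> c x <= x,
        forall a b, b < m.+1 -> arc c a b -> [/\ A a, B b & rg a < rg b],
        forall b, b < m.+1 -> B b -> exists a, arc c a b &
        forall a1 b1 a2, b1 < m.+1 -> arc c a1 b1 -> A a2 -> rg a2 < rg b1 ->
          key a2 < key a1 -> exists2 b2, b2 < b1 & arc c a2 b2].
    move=> lm c' arcm exm optm; exists c'.
    have old a b : b < m -> arc c' a b = arc c a b.
      by move=> bm; apply: eq_arc => x y xb yb; rewrite /c' !ifF //; lia.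
    split=> [x|a b|b|a1 b1 a2]; rewrite ltnS.
    - by rewrite /c'; case: (ltngtP x m) => // [xm _|-> _]; first exact: cle.
    - case: (ltngtP b m) => // [bm _|-> _]; last exact: arcm.
      by rewrite old //; apply: arcAB.
    - case: (ltngtP b m) => // [bm _|-> _]; last exact: exm.
      by move=> Bb; have [a ab] := arcB b bm Bb; exists a; rewrite old.
    - case: (ltngtP b1 m) => // [bm _|-> _] arc1 Aa2 r2 k2.
        rewrite old // in arc1; have [b2 b2b arc2] := opt _ _ _ bm arc1 Aa2 r2 k2.
        by exists b2 => //; rewrite old //; lia.
      have [b2 b2m arc2] := optm _ _ arc1 Aa2 r2 k2.
      by exists b2 => //; rewrite old.
  (* A point that is not a closer gets the label [m], which is fresh because earlier labels are at
     most their positions. *)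
  case: (boolP (B m)) => Bm; last first.
    have noarc a : ~ arc (fun x => if x == m then m else c x) a m.
      case/arcP=> am; rewrite eqxx ltn_eqF // => e _.
      by have := cle a am; lia.
    by apply: (extend m) => //= [a /noarc//|Bm'|a1 a2 /noarc//]; rewrite Bm' in Bm.
  pose free := [pred a : 'I_n | [&& A a, a < rg m & ~~ has (arc c a) (iota 0 m)]].
  (* Otherwise every element of [A] before [rg m] is matched with a closer below [m], contradicting
     the ballot condition at [m]. *)
  have [i0 free0] : exists i, free i.
    apply/existsP; apply: contraT; rewrite negb_exists => /forallP none.
    have : cnt A (rg m) <= cnt B m.
      apply: (@cnt_le_rel _ _ _ _ (arc c)) => [a arm Aa|a a' b]; last exact: arc_opener_uniq.
      have an : a < n by have := rg_le m; lia.
      have := none (Ordinal an); rewrite /= Aa arm negbK /= => /hasP[b].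
      rewrite mem_iota add0n => /andP[_ bm] ab; exists b; split=> //.
      by have [] := arcAB _ _ bm ab.
    by have := bal m mn; rewrite cntS Bm; lia.
  have [i /= /and3P[Ai irm nouse] imin] := arg_minnP (fun a : 'I_n => key a) free0.
  have im := leq_trans irm (rg_le m).
  have {}nouse b : b < m -> ~~ arc c i b.
    by move=> bm; apply: (hasPn nouse); rewrite mem_iota.
  (* An unmatched [i] is the last element of its part so far, so reusing its label at [m] creates
     the arc from [i] to [m]. *)
  have last_i x : i < x -> x < m -> c i <> c x.
    by move=> ix xm /(arc_exists ix)[b arcb bx]; have := nouse b; rewrite arcb; lia.
  have arcm a : arc (fun x => if x == m then c i else c x) a m <-> a = i.
    split=> [/arcP[am]|->]; rewrite ?eqxx.
      rewrite ltn_eqF // => e no; case: (ltngtP a i) => // lt.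
        by case: (no i); rewrite ?lt ?im // ltn_eqF.
      by case: (last_i a).
    apply/arcP; rewrite eqxx ltn_eqF //; split=> // x /andP[ix xm].
    by rewrite ltn_eqF //; apply/nesym/last_i.
  apply: (extend (c i)) => /= [|a /arcm->|_|a1 a2 /arcm->].
  - by have := cle i im; lia.
  - by rewrite -rg_lt.
  - by exists i; apply/arcm.
  - move=> Aa2 r2 k2; rewrite -rg_lt in r2.
    have a2n : a2 < n by have := rg_le m; lia.
    have := imin (Ordinal a2n); rewrite /= Aa2 r2 /=.
    case: hasP => [[b]|_]; last by move=> /(_ isT); lia.
    by rewrite mem_iota add0n => /andP[_ bm] arc2 _; exists b.
have clsB b : b < n -> closers c b = B b.
  move=> bn; apply/closersP/idP => [[a /(arcAB _ _ bn)[]]//|]; exact: arcB.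
have gc : greedy c.
  split=> [a b bn /(arcAB _ _ bn)[]//|a1 b1 a2 b2 b12 b2n arc1 arc2 r2].
  have b1n : b1 < n by lia.
  have [Aa2 _ _] := arcAB _ _ b2n arc2.
  case: (ltngtP (key a1) (key a2)) => // lt.
    by have [b bb1 arcb] := opt _ _ _ b1n arc1 Aa2 r2 lt; have := arc_closer_uniq arcb arc2; lia.
  have e : a1 = a2 by apply: key_inj => //; have := arc_lt arc1; have := arc_lt arc2; lia.
  by subst a2; have := arc_closer_uniq arc1 arc2; lia.
exists c; split=> //.
have [e _] := greedy_ballot gc.
(* The openers lie in [A]; equal counts turn the inclusion into an equality. *)
have eqn : cnt (openers c) n = cnt A n by rewrite e eAB; apply: eq_cnt.
move=> a an; apply: (count_sub_eq _ eqn); last by rewrite mem_iota.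
by move=> x _ /openersP[b bn /(arcAB _ _ bn)[]].
Qed.

End Greedy.

(** * Finite encodings of paths and ballot pairs *)

Definition natext (n : nat) (T : Type) (d : T) (f : 'I_n -> T) (i : nat) : T :=
  oapp f d (insub i).

Lemma natextE n T (d : T) (f : 'I_n -> T) (i : 'I_n) : natext d f i = f i.
Proof. by rewrite /natext valK. Qed.

Lemma natext_lt n T (d : T) (f : 'I_n -> T) i (lt_in : i < n) :
  natext d f i = f (Ordinal lt_in).
Proof. exact: (natextE d f (Ordinal lt_in)). Qed.

Section CardBallot.

Variables (rg : nat -> nat) (n : nat).
Hypothesis rgP : region_start rg.

Let rg_le k : rg k <= k. Proof. by case: rgP. Qed.

Definition natset (X : {set 'I_n}) : pred nat := natext false (fun i => i \in X).

Definition ballots : {set {set 'I_n} * {set 'I_n}} :=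
  [set AB | (cnt (natset AB.1) n == cnt (natset AB.2) n) &&
            [forall k : 'I_n, cnt (natset AB.2) k.+1 <= cnt (natset AB.1) (rg k)]].

Definition paths : {set {ffun 'I_n -> 'I_n.+1}} :=
  [set h : {ffun 'I_n -> 'I_n.+1} | [forall k : 'I_n, h k <= rg k] &&
     [forall k : 'I_n, forall l : 'I_n, (k <= l) ==> (h k <= h l)]].

Definition natpath (h : {ffun 'I_n -> 'I_n.+1}) := natext 0 (fun k => val (h k)).

Lemma ballotsP AB :
  reflect (ballot rg n (natset AB.1) (natset AB.2)) (AB \in ballots).
Proof.
rewrite inE; apply: (iffP andP) => -[eAB bal]; split; rewrite ?eAB //.
- exact/eqP.
- by move=> k kn; apply: (forallP bal (Ordinal kn)).
- by apply/forallP => k; apply: bal.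
Qed.

Lemma pathsP h : reflect (bounded_mono rg n (natpath h)) (h \in paths).
Proof.
rewrite inE; apply: (iffP andP) => -[hrg hmono]; split.
- by move=> k kn; rewrite /natpath natext_lt; apply: (forallP hrg).
- move=> k l kl ln; have kn := leq_ltn_trans kl ln; rewrite /natpath !natext_lt.
  exact: (implyP (forallP (forallP hmono (Ordinal kn)) (Ordinal ln))).
- by apply/forallP => k; have := hrg k; rewrite /natpath natextE; apply.
- apply/forallP => k; apply/forallP => l; apply/implyP => kl.
  by have := hmono k l kl; rewrite /natpath !natextE; apply.
Qed.

Lemma natset_finset (X : pred nat) i : i < n -> natset [set j : 'I_n | X j] i = X i.
Proof. by move=> lt_in; rewrite /natset natext_lt inE. Qed.

Lemma eq_ballot (A A' B B' : pred nat) :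
  (forall i, i < n -> A i = A' i) -> (forall i, i < n -> B i = B' i) ->
  ballot rg n A B -> ballot rg n A' B'.
Proof.
move=> eA eB [eAB bal]; split=> [|k kn].
  by rewrite -(eq_cnt eA) eAB; apply: eq_cnt.
rewrite -(@eq_cnt B B'); last by move=> x xk; apply: eB; lia.
rewrite -(@eq_cnt A A'); first exact: bal.
by move=> x xk; apply: eA; have := rg_le k; lia.
Qed.

Lemma finset_ballots (A B : pred nat) : ballot rg n A B ->
  ([set i : 'I_n | A i], [set i : 'I_n | B i]) \in ballots.
Proof. by move=> bal; apply/ballotsP; apply: eq_ballot bal => i lt_in; rewrite natset_finset. Qed.

Lemma natpath_finfun (h : nat -> nat) k : k < n -> h k <= rg k ->
  natpath [ffun i : 'I_n => inord (h i)] k = h k.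
Proof.
move=> kn hk; rewrite /natpath natext_lt ffunE /= inordK //.
by have := rg_le k; rewrite ltnS; lia.
Qed.

Lemma natpath_inj h h' : (forall k, k < n -> natpath h k = natpath h' k) -> h = h'.
Proof.
move=> e; apply/ffunP => k; apply/val_inj.
by have := e k (ltn_ord k); rewrite /natpath !natextE.
Qed.

Lemma finset_eqP (X Y : pred nat) :
  [set i : 'I_n | X i] = [set i : 'I_n | Y i] -> forall i, i < n -> X i = Y i.
Proof. by move=> /setP e i lt_in; have := e (Ordinal lt_in); rewrite !inE. Qed.

Lemma eq_bounded_mono h h' : (forall k, k < n -> h k = h' k) ->
  bounded_mono rg n h -> bounded_mono rg n h'.
Proof.
move=> e [hrg hmono]; split=> [k kn|k l kl ln]; first by rewrite -e //; apply: hrg.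
by rewrite -!e //; [apply: hmono|lia].
Qed.

Lemma card_paths : 0 < n -> #|paths| = #|ballots|.
Proof.
move=> n0; pose f h := ([set a : 'I_n | heights n (natpath h) a],
                        [set k : 'I_n | jumps (natpath h) k]).
apply: (card_eq_of_bij_on (f := f)) => [h h' /pathsP ph /pathsP ph' [eA eB]|h /pathsP ph|[A B]].
- apply: natpath_inj; apply: (heights_jumps_inj rgP ph ph').
    exact: finset_eqP eA.
  exact: finset_eqP eB.
- exact/finset_ballots/ballot_heights_jumps.
- case/ballotsP/(heights_jumps_surj rgP) => h [hb eA eB].
  have hE : forall k, k < n -> natpath [ffun i : 'I_n => inord (h i)] k = h k.
    by move=> k kn; apply: natpath_finfun => //; case: hb => hrg _; apply: hrg.
  exists [ffun i : 'I_n => inord (h i)].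
    by apply/pathsP; apply: eq_bounded_mono hb => k kn; rewrite hE.
  congr (_, _); apply/setP => i; rewrite inE.
    have := eA i (ltn_ord i); rewrite /natset natextE => <-.
    apply: eq_in_has => k; rewrite mem_iota add0n => /andP[_ kn].
    by rewrite hE.
  have := eB i (ltn_ord i); rewrite /natset natextE => <-.
  rewrite /jumps hE //; congr (_ < _).
  by case: (val i) (ltn_ord i) => // k kn; apply: hE; lia.
Qed.

(** * Permutations *)

Definition natperm (w : 'S_n) : nat -> nat := natext 0 (fun i => val (w i)).

Lemma natpermE (w : 'S_n) (i : 'I_n) : natperm w i = w i.
Proof. exact: natextE. Qed.

Lemma eq_good u u' : (forall i, i < n -> u i = u' i) -> good rg n u -> good rg n u'.
Proof.
move=> e [inju incu avu]; split=> [i j lt_in jn|i j ij jn|i j k kn rij rjk].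
- by rewrite -!e //; apply: inju.
- by rewrite -!e //; [apply: incu|lia].
have jk := rg_ltn rgP rjk; have ij := rg_ltn rgP rij.
rewrite -!e //; try lia.
move=> uki uij; have [x xn ux] := avu _ _ _ kn rij rjk uki uij.
by exists x; rewrite -?e.
Qed.

(** Induction on [v i]: the position with the value just below it also has a smaller value under
    [v'], so [v i <= v' i]; equality follows by symmetry. *)
Lemma perm_order_inj (w w' : 'S_n) :
  (forall i j, (w i < w j) = (w' i < w' j)) -> w = w'.
Proof.
have le (v v' : 'S_n) : (forall i j, (v i < v j) = (v' i < v' j)) ->
    forall i, v i <= v' i.
  move=> vv' i; have [m] := ubnP (v i); elim: m i => // m IH i vim.
  case: (posnP (v i)) => [->//|vi0].
  have lt : (v i).-1 < n by have := ltn_ord (v i); lia.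
  pose j := (v^-1)%g (Ordinal lt).
  have vj : v j = (v i).-1 :> nat by rewrite permKV.
  have := IH j; have := vv' j i; lia.
move=> ww'; apply/permP => i; apply/val_inj/eqP; rewrite eqn_leq !le //.
Qed.

(** The bijection is [deadnum], injective by [good_order_determined] and surjective by
    [good_exists]. *)
Lemma card_paths_of_good (S : {set 'S_n}) :
  (forall w, reflect (good rg n (natperm w)) (w \in S)) -> #|S| = #|paths|.
Proof.
move=> SP; pose f (w : 'S_n) : {ffun 'I_n -> 'I_n.+1} :=
  [ffun k : 'I_n => inord (deadnum rg n (natperm w) k)].
have fE w k : k < n -> natpath (f w) k = deadnum rg n (natperm w) k.
  by move=> kn; apply: natpath_finfun => //; apply: deadnum_le.
apply: (card_eq_of_bij_on (f := f)) => [w w' /SP gw /SP gw' e|w /SP gw|h /pathsP[hrg hmono]].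
- apply: perm_order_inj => i j.
  have := good_order_determined rgP gw gw' _ (ltn_ord i) (ltn_ord j).
  by rewrite !natpermE; apply=> k kn; rewrite -!fE // e.
- apply/pathsP; apply: (@eq_bounded_mono (deadnum rg n (natperm w))).
    by move=> k kn; rewrite fE.
  by split=> [k kn|k l kl ln]; [apply: deadnum_le|apply: deadnum_mono].
- have [u [gu ranu hu]] := good_exists rgP hrg hmono.
  pose v (i : 'I_n) := Ordinal (ranu i (ltn_ord i)).
  have v_inj : injective v.
    move=> i j /(congr1 val) /= e; apply/val_inj; case: gu => inju _ _.
    exact: (inju _ _ (ltn_ord i) (ltn_ord j) e).
  have vE i : i < n -> u i = natperm (perm v_inj) i.
    by move=> lt_in; rewrite /natperm natext_lt permE.
  exists (perm v_inj); first by apply/SP/(eq_good vE).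
  apply: natpath_inj => k kn; rewrite fE // -hu //; apply: eq_count => i.
  by apply: eq_dead => // x y xk yk; rewrite !vE //; lia.
Qed.

(** * Set partitions *)

(** The default 0 from [n] on may coincide with the label of a part, so arcs are compared only when
    they end below [n]. *)
Definition label (P : {set {set 'I_n}}) : nat -> nat :=
  natext 0 (fun x => index (pblock P x) (enum P)).

Lemma setpart_mem P (x : 'I_n) : setpart P -> (pblock P x \in P) * (x \in pblock P x).
Proof.
move=> /and3P[/eqP covP _ _]; have xP : x \in cover P by rewrite covP inE.
by rewrite pblock_mem // mem_pblock.
Qed.

Lemma label_eq P (x y : 'I_n) : setpart P ->
  (label P x == label P y) = (pblock P x == pblock P y).
Proof.
move=> sP; rewrite /label !natextE; apply/eqP/eqP => [|-> //].
by apply: (index_inj set0); rewrite mem_enum setpart_mem.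
Qed.

Lemma setpart_pblock P B (x : 'I_n) : setpart P -> B \in P -> x \in B -> pblock P x = B.
Proof. by move=> /and3P[_ tP _]; apply: def_pblock. Qed.

Lemma bumpE P (a b : 'I_n) : setpart P -> Defs.bump P a b = arc (label P) a b.
Proof.
move=> sP; apply/existsP/arcP => [[B /andP[BP /and4P[aB bB ab /forallP no]]]|[ab /eqP e no]].
  split=> // [|x /andP[ax xb]].
    by apply/eqP; rewrite label_eq // !(setpart_pblock sP BP).
  have xn : x < n by have := ltn_ord b; lia.
  move/eqP; rewrite -[x]/(val (Ordinal xn)) label_eq // (setpart_pblock sP BP aB).
  move/eqP=> ex; have := no (Ordinal xn); rewrite /= ax xb implybF => /negP; apply.
  by rewrite -ex setpart_mem.
rewrite label_eq // in e; exists (pblock P a); rewrite setpart_mem // setpart_mem //=.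
rewrite (eqP e) setpart_mem // ab /=; apply/forallP => x; apply/implyP => xB.
apply/negP => /no /eqP; rewrite label_eq // (eqP e) (setpart_pblock sP _ xB) ?eqxx //.
by rewrite setpart_mem.
Qed.

(** By [arc_chain] the arcs determine which elements share a part. *)
Lemma setpart_arc_inj P P' : setpart P -> setpart P' ->
  (forall a b, b < n -> arc (label P) a b = arc (label P') a b) -> P = P'.
Proof.
have sub Q Q' : setpart Q -> setpart Q' ->
    (forall a b, b < n -> arc (label Q) a b = arc (label Q') a b) ->
    forall x y, pblock Q x = pblock Q y -> pblock Q' x = pblock Q' y.
  move=> sQ sQ' e x y exy; apply/eqP; rewrite -label_eq //.
  have chain (a b : 'I_n) : a < b -> pblock Q a = pblock Q b -> label Q' a = label Q' b.
    move=> ab eab.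
    apply: (@arc_chain (label Q) (fun x y => label Q' x = label Q' y) n) => //.
    - by move=> ? ? ? ->.
    - by move=> c d dn; rewrite e // => /arcP[].
    - by apply/eqP; rewrite label_eq // eab.
  case: (ltngtP x y) => [lt|gt|/val_inj->//].
    by apply/eqP/chain.
  by rewrite eq_sym; apply/eqP/chain.
have pbl Q (x y : 'I_n) : setpart Q -> (y \in pblock Q x) = (pblock Q x == pblock Q y).
  move=> sQ; have /and3P[/eqP cQ tQ _] := sQ.
  by rewrite eq_pblock // cQ inE.
move=> sP sP' e.
have eqb x : pblock P x = pblock P' x.
  apply/setP => y; rewrite !pbl //.
  apply/eqP/eqP; first exact: sub.
  by apply: sub => // a b bn; rewrite e.
have half (Q Q' : {set {set 'I_n}}) : setpart Q -> setpart Q' -> (forall x, pblock Q x = pblock Q' x) ->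
    forall B, B \in Q -> B \in Q'.
  move=> sQ sQ' eQ B BQ; have /and3P[_ _ n0] := sQ.
  have /set0Pn[x xB] : B != set0 by apply: contraNneq n0 => <-.
  by rewrite -(setpart_pblock sQ BQ xB) eQ setpart_mem.
apply/setP => B; apply/idP/idP; first exact: half.
by apply: half => // x; rewrite eqb.
Qed.

Definition fibres (c : nat -> nat) : {set {set 'I_n}} :=
  preim_partition (fun x : 'I_n => c x) [set: 'I_n].

Lemma setpart_fibres c : setpart (fibres c).
Proof. exact: preim_partitionP. Qed.

Lemma label_fibres c a b : b < n -> arc (label (fibres c)) a b = arc c a b.
Proof.
move=> bn; apply: eq_arc => x y xb yb.
have xn : x < n by lia.
have yn : y < n by lia.
rewrite -[x]/(val (Ordinal xn)) -[y]/(val (Ordinal yn)) label_eq ?setpart_fibres //.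
have /and3P[/eqP cQ tQ _] := setpart_fibres c.
rewrite eq_pblock // ?cQ ?inE // /fibres /preim_partition.
rewrite pblock_equivalence_partition ?inE //.
by split=> // /eqP->.
Qed.

(** A general [key] serves both kinds of partitions. Injectivity comes from [greedy_arcs_uniq],
    surjectivity from the fibres of the labelling given by [greedy_exists]. *)
Lemma card_ballots_of_greedy key (S : {set {set {set 'I_n}}}) :
  (forall a a', a < n -> a' < n -> key a = key a' -> a = a') ->
  (forall P, reflect (setpart P /\ greedy rg n key (label P)) (P \in S)) ->
  #|S| = #|ballots|.
Proof.
move=> key_inj SP.
pose f P := ([set a : 'I_n | openers n (label P) a], [set b : 'I_n | closers (label P) b]).
apply: (card_eq_of_bij_on (f := f)).
- move=> P P' /SP[sP gP] /SP[sP' gP'] [eA eB].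
  apply: setpart_arc_inj => //; apply: (greedy_arcs_uniq key_inj gP gP').
    exact: finset_eqP eA.
  exact: finset_eqP eB.
- by move=> P /SP[sP gP]; apply/finset_ballots/(greedy_ballot rgP gP).
- move=> [A B] /ballotsP/(greedy_exists rgP key_inj)[c [[rgc gc] eA eB]].
  exists (fibres c).
    apply/SP; split; first exact: setpart_fibres.
    split=> [a b bn|a1 b1 a2 b2 b12 b2n]; rewrite !label_fibres //; try lia.
      exact: rgc.
    exact: gc.
  congr (_, _); apply/setP => i; rewrite inE.
    have := eA i (ltn_ord i); rewrite /natset natextE => <-.
    apply: eq_in_has => b; rewrite mem_iota add0n => /andP[_ bn].
    by rewrite label_fibres.
  have := eB i (ltn_ord i); rewrite /natset natextE => <-.
  by apply: eq_has => a; rewrite label_fibres.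
Qed.

End CardBallot.

(** * The three parabolic families *)

Section ParabolicRegions.

Variables (n : nat) (J : {set 'I_n.-1}).

(** A reflection [j] outside [J] separates [j] from [j.+1]. The last such cut before [p] gives the
    start; the empty maximum 0 is the start of the first region. *)
Definition regStart (p : nat) : nat := \max_(j < n.-1 | (j < p) && (j \notin J)) j.+1.

Lemma regStartP : region_start regStart.
Proof.
have le k : regStart k <= k by apply/bigmax_leqP => j /andP[].
have ge k (j : 'I_n.-1) : j < k -> j \notin J -> j < regStart k.
  by move=> jk jJ; apply: (bigmax_sup j); rewrite ?jk.
split=> // i k; apply/idP/idP => [|lt]; first exact: leq_ltn_trans.
rewrite ltnNge; apply/negP => ki; move: lt; apply/negP; rewrite -leqNgt.
apply/bigmax_leqP => j /andP[jk jJ]; apply: (ge) => //.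
exact: leq_trans (ge k j jk jJ) ki.
Qed.

Lemma sameRegE p q : sameReg J p q = (regStart p == regStart q).
Proof.
wlog pq : p q / p <= q.
  move=> H; case/orP: (leq_total p q) => [/H//|/H].
  by rewrite eq_sym => <-; rewrite /sameReg minnC maxnC.
rewrite /sameReg (minn_idPl pq) (maxn_idPr pq).
apply/forallP/eqP => [all_in|e k].
  apply: eq_bigl => j; case: (boolP (j \in J)) => jJ; rewrite ?andbF ?andbT //.
  have := all_in j; rewrite (negbTE jJ) implybF; lia.
apply/implyP => /andP[pk kq]; apply: contraT => kJ.
have [le _] := regStartP; have := le p; rewrite e.
have : k < regStart q by apply: (bigmax_sup k); rewrite ?kq.
lia.
Qed.

Let rg_mono := rg_mono regStartP.

Lemma regStart_lt p q : p < q -> ~~ sameReg J p q = (regStart p < regStart q).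
Proof. by move=> pq; rewrite sameRegE ltn_neqAle rg_mono ?andbT // ltnW. Qed.

Lemma regStart_ltn p q : regStart p < regStart q -> p < q.
Proof. exact: rg_ltn regStartP _ _. Qed.

Lemma inJ_sameReg i : i.+1 < n -> inJ J i = sameReg J i i.+1.
Proof.
move=> lt_in; have lt' : i < n.-1 by lia.
apply/existsP/forallP => [[k /andP[/eqP ki kJ]] l|all_in].
  apply/implyP => li; suff -> : l = k by [].
  by apply/val_inj; rewrite /= ki; lia.
exists (Ordinal lt'); rewrite eqxx /=.
by apply: (implyP (all_in (Ordinal lt'))) => /=; lia.
Qed.

Lemma SJP w : reflect (forall i j, i < j -> j < n -> regStart i = regStart j ->
    natperm w i < natperm w j) (w \in SJ J).
Proof.
rewrite inE; apply: (iffP forallP) => [inc i j ij jn e|inc i].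
  have step k (kn : k.+1 < n) : regStart k = regStart k.+1 -> natperm w k < natperm w k.+1.
    move=> ek; have := forallP (inc (Ordinal (ltnW kn))) (Ordinal kn).
    rewrite /= eqxx inJ_sameReg // sameRegE ek eqxx /=.
    by rewrite /natperm (natext_lt _ _ (ltnW kn)) (natext_lt _ _ kn).
  elim: j ij jn e => // j IH; rewrite ltnS leq_eqVlt => /orP[/eqP<-|ij] jn e.
    exact: step.
  have e1 : regStart i = regStart j.
    by have := rg_mono (ltnW ij); have := rg_mono (leqnSn j); lia.
  by apply: (ltn_trans (IH ij (ltnW jn) e1)); apply: step => //; rewrite -e1.
apply/forallP => j; apply/implyP => /andP[/eqP ij inJi].
rewrite /= -!natpermE; apply: inc => //; first by rewrite ij.
apply/eqP; have := ltn_ord j; rewrite ij => lt_in.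
by rewrite -sameRegE -inJ_sameReg.
Qed.

Lemma SJ231P w : reflect (good regStart n (natperm w)) (w \in SJ231 J).
Proof.
rewrite inE; apply: (iffP andP) => [[/SJP inc av]|[inju inc av]]; last first.
  split; first exact/SJP.
  apply/negP => /existsP[i /existsP[j /existsP[k]]].
  case/and5P=> ij jk; rewrite regStart_lt // => rij; rewrite regStart_lt // => rjk.
  case/and4P=> _ ki wij /eqP e.
  have := av i j k (ltn_ord k) rij rjk; rewrite !natpermE => /(_ ki wij)[x _].
  by move: e => /= ->; rewrite ltnS => /andP[]; case: ltngtP.
split=> // [i j lt_in jn|i j k kn rij rjk].
  rewrite /natperm !natext_lt => /val_inj/perm_inj.
  by move/(congr1 val).
have jk := regStart_ltn rjk; have ij := regStart_ltn rij.
have jn := ltn_trans jk kn; have lt_in := ltn_trans ij jn.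
rewrite /natperm (natext_lt _ _ lt_in) (natext_lt _ _ jn) (natext_lt _ _ kn).
move=> wki wij; set i' := Ordinal lt_in in wki wij *; set k' := Ordinal kn in wki *.
have [e|ne] := eqVneq (val (w i')) (w k').+1.
  case/negP: av; apply/existsP; exists i'; apply/existsP; exists (Ordinal jn).
  apply/existsP; exists k'; rewrite /= ij jk wki wij e eqxx.
  rewrite !regStart_lt // ?rij ?rjk ?(ltn_trans rij rjk) //.
  exact: ltn_trans jk.
have {}ne : (w k').+1 < w i' by rewrite ltn_neqAle eq_sym ne.
have lt := ltn_trans ne (ltn_ord (w i')).
(* The witness is the position whose value is one more than that of [k']. *)
exists ((w^-1)%g (Ordinal lt)) => //.
by rewrite natextE permKV /= leqnn.
Qed.

(** If region starts increase along arcs, then by [arc_chain] they increase between any two elements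
    of a part. *)
Lemma cond1P P : setpart P -> reflect
  (forall a b, b < n -> arc (label P) a b -> regStart a < regStart b) (cond1 J P).
Proof.
move=> sP; apply: (iffP forallP) => [c1 a b bn ab|arcs B].
  have an : a < n by have := arc_lt ab; lia.
  have := ab; rewrite -[a]/(val (Ordinal an)) -[b]/(val (Ordinal bn)) -bumpE //.
  case/existsP=> B /andP[BP /and4P[aB bB ltab _]].
  rewrite -regStart_lt //.
  have := forallP (implyP (c1 B) BP) (Ordinal an); rewrite aB /=.
  move/forallP/(_ (Ordinal bn)); rewrite bB /= => /implyP; apply.
  by apply: contraTneq ltab => ->; rewrite ltnn.
apply/implyP => BP; apply/forallP => a; apply/implyP => aB.
apply/forallP => b; apply/implyP => bB; apply/implyP => ab.
have chain (x y : 'I_n) : x \in B -> y \in B -> x < y -> regStart x < regStart y.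
  move=> xB yB xy.
  apply: (@arc_chain (label P) (fun x y => regStart x < regStart y) n) => //.
    by move=> ? ? ?; apply: ltn_trans.
  by apply/eqP; rewrite label_eq // !(setpart_pblock sP BP).
rewrite sameRegE; case: (ltngtP a b) => [lt|lt|/val_inj e].
- by have := chain _ _ aB bB lt; lia.
- by have := chain _ _ bB aB lt; lia.
- by rewrite e eqxx in ab.
Qed.

(** With key [id], two arcs violating greediness are nested. Conversely, nested arcs violate it: the
    outer left end precedes the inner one, so it lies in an earlier region than the inner right
    end. *)
Lemma NNJP P : reflect (setpart P /\ greedy regStart n id (label P)) (P \in NNJ J).
Proof.
rewrite inE; apply: (iffP and3P) => [[sP c1 nn]|[sP [rgc gc]]]; last first.
  split=> //; first exact/cond1P.
  apply/negP => /existsP[i1 /existsP[i2 /existsP[j1 /existsP[j2]]]].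
  case/and3P; rewrite !bumpE // => arci arcj /and4P[_ ij jj ji].
  have r : regStart i1 < regStart j2.
    by apply: leq_ltn_trans (rg_mono (ltnW ij)) _; apply: rgc.
  by have /= := gc _ _ _ _ ji (ltn_ord i2) arcj arci r; rewrite ltnNge (ltnW ij).
have rgc := cond1P sP c1; split=> //; split=> // a1 b1 a2 b2 b12 b2n arc1 arc2 r2 /=.
have b1n : b1 < n by lia.
have a1n : a1 < n by have := arc_lt arc1; lia.
have a2n : a2 < n by have := arc_lt arc2; lia.
case: (ltngtP a1 a2) => // [lt|e]; last first.
  by subst a2; have := arc_closer_uniq arc1 arc2; lia.
case/negP: nn; apply/existsP; exists (Ordinal a2n); apply/existsP; exists (Ordinal b2n).
apply/existsP; exists (Ordinal a1n); apply/existsP; exists (Ordinal b1n).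
rewrite !bumpE // arc1 arc2 /= lt b12 (arc_lt arc1) !andbT.
by apply/eqP => -[e _]; rewrite e ltnn in lt.
Qed.

(* Openers of later regions come first, and inside a region they are taken
   from left to right. *)
Definition nckey (a : nat) : nat := (n - regStart a) * n + a.

(** As [a < n], the multiples of [n] are compared first and the order is lexicographic. *)
Lemma nckey_lt a a' : a < n -> a' < n ->
  (nckey a < nckey a') =
  (regStart a' < regStart a) || (regStart a == regStart a') && (a < a').
Proof.
move=> an a'n; have [le _] := regStartP; have := le a; have := le a'.
rewrite /nckey; case: (ltngtP (regStart a) (regStart a')) => [lt|lt|->] le1 le2 /=.
- have := leq_mul2r n (n - regStart a').+1 (n - regStart a); rewrite mulSn; lia.
- have := leq_mul2r n (n - regStart a).+1 (n - regStart a'); rewrite mulSn; lia.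
- by rewrite ltn_add2l.
Qed.

Lemma nckey_inj a a' : a < n -> a' < n -> nckey a = nckey a' -> a = a'.
Proof.
move=> an a'n e; have := nckey_lt an a'n; have := nckey_lt a'n an.
by rewrite e ltnn; lia.
Qed.

(** The key order can fail in two ways. If [a2] lies in a later region than [a1], the arcs cross as
    excluded by [NC2]; if both lie in one region with [a2 < a1], they are nested as excluded by
    [NC3]. *)
Lemma NCJP P : reflect (setpart P /\ greedy regStart n nckey (label P)) (P \in NCJ J).
Proof.
rewrite inE; apply: (iffP and4P) => [[sP c1 nc2 nc3]|[sP [rgc gc]]]; last first.
  split=> //; first exact/cond1P.
  - apply/forallP => i1; apply/forallP => i2; apply/forallP => j1; apply/forallP => j2.
    apply/implyP => /and3P[]; rewrite !bumpE // => arci arcj /and4P[_ ij ji i2j2].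
    apply: contraT; rewrite negb_or regStart_lt // => /andP[rij].
    rewrite sameRegE eq_sym -sameRegE regStart_lt // => rji.
    by have := gc _ _ _ _ i2j2 (ltn_ord _) arci arcj rji; rewrite nckey_lt //; lia.
  - apply/forallP => i1; apply/forallP => i2; apply/forallP => j1; apply/forallP => j2.
    apply/implyP => /and3P[]; rewrite !bumpE // => arci arcj /and4P[_ ij jj ji].
    rewrite sameRegE; apply/eqP => e.
    have rj := rgc _ _ (ltn_ord _) arcj; rewrite -e in rj.
    by have := gc _ _ _ _ ji (ltn_ord _) arcj arci rj; rewrite nckey_lt //; lia.
have rgc := cond1P sP c1; split=> //; split=> // a1 b1 a2 b2 b12 b2n arc1 arc2 r2 /=.
have b1n : b1 < n by lia.
have a1n : a1 < n by have := arc_lt arc1; lia.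
have a2n : a2 < n by have := arc_lt arc2; lia.
rewrite nckey_lt //; case: (ltngtP (regStart a1) (regStart a2)) => //= [lt|e].
  have a12 := regStart_ltn lt; have a2b1 := regStart_ltn r2.
  have := forallP (forallP (forallP (forallP nc2 (Ordinal a1n)) (Ordinal b1n)) (Ordinal a2n)) (Ordinal b2n).
  rewrite !bumpE // arc1 arc2 /= a12 a2b1 b12 !sameRegE (ltn_eqF lt) (gtn_eqF r2) /=.
  by rewrite !andbT implybF negbK => /eqP[e _]; lia.
case: (ltngtP a1 a2) => // [lt|e']; last first.
  by subst a2; have := arc_closer_uniq arc1 arc2; lia.
have := forallP (forallP (forallP (forallP nc3 (Ordinal a2n)) (Ordinal b2n)) (Ordinal a1n)) (Ordinal b1n).
rewrite !bumpE // arc1 arc2 /= lt (arc_lt arc1) b12 sameRegE e eqxx /= !andbT implybF negbK.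
by case/eqP; lia.
Qed.

End ParabolicRegions.

Theorem theorem1p2 (n : nat) (hn : 0 < n) (J : {set 'I_n.-1}) :
  (exists f : {w : 'S_n | w \in SJ231 J} -> {P : {set {set 'I_n}} | P \in NCJ J},
      bijective f) /\
  (exists g : {P : {set {set 'I_n}} | P \in NCJ J} -> {P : {set {set 'I_n}} | P \in NNJ J},
      bijective g) /\
  #|SJ231 J| = #|NCJ J| /\ #|NCJ J| = #|NNJ J|.
Proof.
have rgP := regStartP J.
have cS : #|SJ231 J| = #|ballots (regStart J) n|.
  by rewrite (card_paths_of_good rgP (SJ231P J)) (card_paths rgP).
have cNC : #|NCJ J| = #|ballots (regStart J) n|.
  exact: (card_ballots_of_greedy rgP (@nckey_inj n J) (NCJP J)).
have cNN : #|NNJ J| = #|ballots (regStart J) n|.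
  by apply: (card_ballots_of_greedy rgP _ (NNJP J)) => a a'.
have e1 : #|SJ231 J| = #|NCJ J| by rewrite cS cNC.
have e2 : #|NCJ J| = #|NNJ J| by rewrite cNC cNN.
by split; [|split]; [exact: bijective_of_card_eq|exact: bijective_of_card_eq|].
Qed.
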